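(* Let $j,r\ge 0$ and $k\ge 1$ be integers with $j+r\le k$. Then \[ \sum_{s_1\ge\cdots\ge s_k\ge 0}\frac{q^{s_1^2+\cdots+s_k^2-s_1-\cdots-s_j+s_{k-r+1}+\cdots+s_k}}{(q)_{s_1-s_2}\cdots(q)_{s_{k-1}-s_k}(q^2;q^2)_{s_k}}=\sum_{f}q^{|f|}, \] where the sum on the right runs over all frequency sequences $f=(f_i)_{i\ge0}$ such that (i) $f_i+f_{i+1}\le k$ for all $i\ge0$, (ii) $f_0\le j-\max\{f_0+f_1-(k-r),0\}$, and (iii) whenever $f_i+f_{i+1}=k$ for some $i\ge0$, we have $if_i+(i+1)f_{i+1}\equiv k+r-j\pmod 2$.
   Context: A frequency sequence is a sequence $(f_i)_{i\ge0}$ of non-negative integers with only finitely many nonzero entries; its size is $|f|=\sum_{i\ge0} i f_i$. $q$ is a complex number with $|q|<1$ (or a formal variable); $(a;q)_n=\prod_{m=0}^{n-1}(1-aq^m)$, $(a)_n=(a;q)_n$. $s_1+\cdots+s_j=\sum_{i=1}^j s_i$, $s_{k-r+1}+\cdots+s_k=\sum_{i=k-r+1}^k s_i$. *)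

(* Defs.v *)
From HB Require Import structures.
From mathcomp Require Import all_boot all_order all_algebra.
From mathcomp Require Import finmap.
From mathcomp Require Import complex.
From mathcomp Require Import boolp classical_sets functions reals topology normedtype.
From mathcomp Require Import summability.
Set Implicit Arguments.
Unset Strict Implicit.
Unset Printing Implicit Defensive.
Import Order.TTheory GRing.Theory Num.Theory.
Import numFieldNormedType.Exports.
Local Open Scope classical_set_scope.
Local Open Scope ring_scope.

(* Unordered (hence order-independent) summation: the finite partial sums of x
   over D converge to l along the finite sets ordered by inclusion. Over the
   complex numbers this is absolute summability with sum l. *)
Definition has_sum (K : numFieldType) (V : normedModType K) (I : choiceType)
    (D : set I) (x : I -> V) (l : V) : Prop :=
  partial_sum (patch (fun=> 0) D x) @ totally --> l.

Definition qpoch (C : comNzRingType) (a q : C) (n : nat) : C :=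
  \prod_(m < n) (1 - a * q ^+ m).

(* 1-based access: part s i is s_i for 1 <= i <= size s. *)
Definition part (s : seq nat) (i : nat) : nat := nth 0%N s i.-1.

Definition ms_exponent (j r k : nat) (s : seq nat) : int :=
  \sum_(1 <= i < k.+1) (part s i)%:Z ^+ 2
  - \sum_(1 <= i < j.+1) (part s i)%:Z
  + \sum_((k - r + 1)%N <= i < k.+1) (part s i)%:Z.

Definition ms_term (C : fieldType) (q : C) (j r k : nat) (s : seq nat) : C :=
  q ^ ms_exponent j r k s /
  (\prod_(1 <= i < k) qpoch q q (part s i - part s i.+1)
   * qpoch (q ^+ 2) (q ^+ 2) (part s k)).

Definition freq_seq := {fsfun nat -> nat with 0%N}.

Definition fsize (f : freq_seq) : nat := (\sum_(i <- finsupp f) i * f i)%N.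

Definition admissible (j r k : nat) (f : freq_seq) : Prop :=
  [/\ forall i, (f i + f i.+1 <= k)%N,
      (f 0%N)%:Z <= j%:Z - Num.max ((f 0%N)%:Z + (f 1%N)%:Z - (k%:Z - r%:Z)) 0
    & forall i, (f i + f i.+1)%N = k ->
        (i%:Z * (f i)%:Z + i.+1%:Z * (f i.+1)%:Z
           = k%:Z + r%:Z - j%:Z %[mod 2])%Z].

(* Main.v *)
Require Import Defs.
From HB Require Import structures.
From mathcomp Require Import all_boot all_order all_algebra.
From mathcomp Require Import finmap.
From mathcomp Require Import complex.
From mathcomp Require Import boolp classical_sets functions reals topology normedtype.
From mathcomp Require Import summability.
From mathcomp Require Import sequences.
From mathcomp Require Import ring lra zify.
Import Order.TTheory GRing.Theory Num.Theory.
Import numFieldNormedType.Exports.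
Local Open Scope classical_set_scope.
Local Open Scope ring_scope.

Set Implicit Arguments.
Unset Strict Implicit.
Unset Printing Implicit Defensive.

(* Shifting [s_1, ..., s_i] by one in the multisum cancels a factor of the
   denominator, which yields contiguous relations between multisums with
   different linear exponents. Telescoping them gives, for the sum [h j r x] with
   an extra weight [x ^ (s_1 + ... + s_k)],
     [h (j+1) (r+1) x = h j r x + x ^ (j+1) * h 0 (j+r+2) x],
     [h (j+1) 0 x = h j 1 x + x ^ (j+1) * h 0 (j+1) x],
     [h 0 r x = h (k-r) 0 (x * q)],
   hence [h j r x = sum over a <= j of x ^ a * h (m a) 0 (x * q)] for an explicit
   [m a]. Splitting an admissible sequence according to [f 0 = a] gives the same
   recurrence for the generating function of the sequences supported on
   [[0, L)], with [x] marking the number of parts. As both sides tend to [1] when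
   [x] tends to [0], iterating the recurrence shows that they agree in the limit. *)

(** * Contiguous relations *)

(** The list holds the linear weights of the nested variables, followed by an auxiliary entry. The
    side condition lets the auxiliary entry change only from 2 to 1. *)
Definition contiguous (C : comNzRingType) (x q : C) (F : seq nat -> C) : Prop :=
  forall p a b t, (t != [::]) || (b == 1%N) ->
  F (p ++ a :: b.+1 :: t) =
  F (p ++ a.+1 :: b :: t) +
  x ^+ (size p).+1 * q ^+ (sumn p + a) * F (map (addn 2) p ++ a.+2 :: b.+1 :: t).

Section Contiguous.
Variables (C : comNzRingType) (x q : C) (F : seq nat -> C).
Hypothesis contF : contiguous x q F.

Lemma nseqSr T n (y : T) s : nseq n.+1 y ++ s = nseq n y ++ y :: s.
Proof. by elim: n => //= n <-. Qed.

(** An entry 2 travels left through a block of 1s by exchanges [1, 2 -> 2, 1], each leaving one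
    error term. *)
Lemma contiguous_move_left p v t :
  F (p ++ nseq v 1%N ++ 2%N :: t) = F (p ++ 2%N :: nseq v 1%N ++ t) +
  \sum_(u < v) x ^+ (size p + u.+1) * q ^+ (sumn p + u.+1) *
    F (map (addn 2) p ++ nseq u.+1 3%N ++ 2%N :: nseq (v - u.+1) 1%N ++ t).
Proof.
elim: v t => [|v IHv] t; first by rewrite big_ord0 addr0.
rewrite nseqSr catA contF ?orbT // -catA.
rewrite (IHv (1%N :: t)) -nseqSr big_ord_recr /= subnn -addrA; congr (_ + _).
rewrite size_cat size_nseq sumn_cat sumn_nseq mul1n map_cat map_nseq -!catA.
rewrite -[3%N :: _ :: t]/([:: 3%N] ++ 2%N :: t) -nseqSr addn1.
rewrite -!addnS; congr (_ + _).
apply: eq_bigr => u _; congr (_ * F (_ ++ _ :: _ ++ _ :: _)).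
by rewrite -nseqSr subSn.
Qed.

(** An entry 2 travels right through a block of 3s; a nonempty [t] keeps the exchanges away from the
    auxiliary entry. *)
Lemma contiguous_move_right p v t : t != [::] ->
  F (p ++ 2%N :: nseq v 3%N ++ t) = F (p ++ nseq v 3%N ++ 2%N :: t) +
  \sum_(u < v) x ^+ (size p + u.+1) * q ^+ (sumn p + 2 + 3 * u) *
    F (map (addn 2) p ++ nseq u 5%N ++ 4%N :: nseq (v - u) 3%N ++ t).
Proof.
move=> t0; elim: v p => [|v IHv] p; first by rewrite big_ord0 addr0.
rewrite /= contF; last by case: (v) => //; rewrite t0.
rewrite -cat_rcons IHv big_ord_recl -!addrA /=; rewrite cat_rcons; congr (_ + _).
rewrite addrC; congr (_ + _); first by rewrite addn1 addn0.
apply: eq_bigr => u _; rewrite size_rcons sumn_rcons map_rcons cat_rcons /=.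
rewrite /bump /= add1n subSS addSnnS.
by congr (_ * q ^+ _ * _); lia.
Qed.

Lemma exchange_triangle (m : nat) (G : nat -> nat -> C) :
  \sum_(t < m.+1) \sum_(u < t) G u (t - u)%N =
  \sum_(u < m.+1) \sum_(v < m - u) G u v.+1.
Proof.
elim: m G => [|m IHm] G.
  by rewrite !big_ord1 /= !big_ord0.
rewrite big_ord_recl big_ord0 add0r.
under eq_bigr => t _ do rewrite lift0 big_ord_recl subn0.
rewrite big_split /= [RHS]big_ord_recl /= subn0; congr (_ + _).
exact: IHm (fun u => G u.+1).
Qed.

(** The expansion of [F (nseq m 1%N ++ nseq r.+1 2%N)] by [contiguous_move_left], with [j] entries 2
    put in front of every list. *)
Let U m j r := \sum_(u < m.+1) x ^+ u * q ^+ u *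
  F (nseq j 2%N ++ nseq u 3%N ++ 2%N :: nseq (m - u) 1%N ++ nseq r 2%N).

Let U0 m r : U m 0 r = F (nseq m 1%N ++ nseq r.+1 2%N).
Proof.
rewrite /U big_ord_recl subn0 /= mul1r mul1r.
by rewrite (contiguous_move_left [::] m (nseq r 2%N)).
Qed.

(* Bringing the two entries [2] next to each other, from the left on one side and
   from the right on the other, leaves the same error terms [X u v], [u + v <= m]. *)
Let US m j r : U m j.+1 r = U m j r.+1.
Proof.
pose A t := F (nseq j 2%N ++ nseq t 3%N ++
               2%N :: 2%N :: nseq (m - t) 1%N ++ nseq r 2%N).
pose X u v := x ^+ (2 * u + v + j.+1) * q ^+ (4 * u + v + 2 * j.+1) *
  F (nseq j 4%N ++ nseq u 5%N ++ 4%N :: nseq v 3%N ++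
     2%N :: nseq (m - (u + v)) 1%N ++ nseq r 2%N).
transitivity (\sum_(t < m.+1) x ^+ t * q ^+ t * A t +
              \sum_(t < m.+1) \sum_(u < t) X u (t - u)%N).
  rewrite -big_split; apply: eq_bigr => t _ /=.
  rewrite -[_ :: nseq j 2%N ++ _]/(nseq j.+1 2%N ++ _) nseqSr contiguous_move_right //.
  rewrite mulrDr; congr (_ + _); rewrite mulr_sumr; apply: eq_bigr => u _.
  have ut := ltn_ord u; have tm := ltn_ord t.
  rewrite size_nseq sumn_nseq map_nseq mulrA /X subnKC 1?ltnW //.
  rewrite mulrACA -!exprD; congr (x ^+ _ * q ^+ _ * _); lia.
rewrite exchange_triangle -big_split; apply: eq_bigr => t _ /=.
have /= := contiguous_move_left (nseq j 2%N ++ rcons (nseq t 3%N) 2%N)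
  (m - t) (nseq r 2%N).
rewrite -!catA !cat_rcons => ->; rewrite mulrDr; congr (_ + _).
rewrite mulr_sumr; apply: eq_bigr => u _.
have um := ltn_ord u; have tm := ltn_ord t.
rewrite !size_cat !size_rcons !size_nseq !sumn_cat !sumn_rcons !sumn_nseq.
rewrite !map_cat !map_rcons !map_nseq -!catA !cat_rcons mulrA mulrACA -!exprD /X.
by rewrite subnDA; congr (x ^+ _ * q ^+ _ * _); lia.
Qed.

(** The first 2 moves left until it meets the zeros, where one exchange turns [0, 2] into [1, 1].
    All error terms together form [x ^+ j.+1 * U m j.+1 r], which [US] identifies with the last
    term. *)
Lemma contiguous_shift j m r :
  F (nseq j.+1 0%N ++ nseq m 1%N ++ nseq r.+1 2%N) =
  F (nseq j 0%N ++ nseq m.+2 1%N ++ nseq r 2%N) +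
  x ^+ j.+1 * F (nseq m 1%N ++ nseq (j + r).+2 2%N).
Proof.
have U_diag i s : U m i s = U m 0 (i + s).
  by elim: i s => // i IHi s; rewrite US IHi addSnnS.
rewrite -addSn -U0 -U_diag /U big_ord_recl subn0 mul1r mul1r.
have /= -> := contiguous_move_left (nseq j.+1 0%N) m (nseq r 2%N).
rewrite -[_ :: _ ++ _]/(nseq j.+1 0%N ++ _) nseqSr contF ?orbT //.
rewrite sumn_nseq size_nseq map_nseq mul0n add0n mulr1 -addrA.
rewrite -!nseqSr mulrDr; congr (_ + (_ + _)).
by rewrite mulr_sumr; apply: eq_bigr => u _; rewrite exprD !mulrA.
Qed.

End Contiguous.

(** * Nested layers and their contiguous relation *)

Section Layers.
Variables (C : fieldType) (q : C).
Hypothesis q_not_root : forall n, 1 - q ^+ n.+1 != 0.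
Implicit Types (x w : C) (den u v : nat -> C) (c : nat) (cs : seq nat).

(** One nested summation. [den] is [qpoch q q] for the inner variables and constantly 1 for the
    outermost one, where [N] only truncates. *)
Definition layer x den c u (N : nat) : C :=
  \sum_(s < N.+1) x ^+ s * q ^+ (s * s.-1 + c * s) / den (N - s)%N * u s.

(* Exponents are shifted by one ([c] stands for the linear form [(c - 1) s]) to
   stay in [nat]. The last entry [c] of the list is an auxiliary one: it carries
   the weight [q ^ (2 - c) s] of the innermost variable. *)
Fixpoint nested x cs : nat -> C :=
  match cs with
  | [::] => fun=> 1
  | [:: c] => fun N => q ^+ ((2 - c) * N) / qpoch (q ^+ 2) (q ^+ 2) N
  | c :: cs' => layer x (qpoch q q) c (nested x cs')
  end.

Definition multisum x cs (N : nat) : C :=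
  if cs is c :: cs' then layer x (fun=> 1) c (nested x cs') N else 1.

Lemma nested_cons x c cs : cs != [::] ->
  nested x (c :: cs) = layer x (qpoch q q) c (nested x cs).
Proof. by case: cs. Qed.

Lemma qpochS (a b : C) n : qpoch a b n.+1 = qpoch a b n * (1 - a * b ^+ n).
Proof. by rewrite /qpoch big_ord_recr. Qed.

Lemma qpoch0 (a b : C) : qpoch a b 0 = 1.
Proof. by rewrite /qpoch big_ord0. Qed.

Definition shift_rel w u v1 v2 :=
  u 0%N = v1 0%N /\ forall s, u s.+1 = v1 s.+1 + w * v2 s.

Lemma eq_layer x den c u v : u =1 v -> layer x den c u =1 layer x den c v.
Proof. by move=> uv N; apply: eq_bigr => s _; rewrite uv. Qed.

(** Putting [s + 1] for [s] in the [v2] part keeps [N - s], and the exponent becomes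
    [c + s * (s - 1) + (c + 2) * s]. *)
Lemma layer_shift x den c u v1 v2 w : shift_rel w u v1 v2 ->
  shift_rel (w * x * q ^+ c) (layer x den c u) (layer x den c v1)
    (layer x den c.+2 v2).
Proof.
move=> [u0 uS]; split=> [|N]; first by rewrite /layer !big_ord1 u0.
rewrite /layer big_ord_recl [in RHS]big_ord_recl u0 -addrA; congr (_ + _).
rewrite mulr_sumr -big_split; apply: eq_bigr => s _ /=.
rewrite /bump /= add1n uS mulrDr; congr (_ + _).
have -> : (s.+1 * s + c * s.+1 = c + (s * s.-1 + c.+2 * s))%N.
  by case: (nat_of_ord s) => [|n] /=; nia.
rewrite subSS exprS exprD.
have mulE (X Y Q D V : C) : x * X * (Y * Q) * D * (w * V) =
  w * x * Y * (X * Q * D * V) by ring.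
exact: mulE.
Qed.

Lemma layerS x den c u N :
  layer x den c (fun s => q ^+ s * u s) N = layer x den c.+1 u N.
Proof.
apply: eq_bigr => s _.
have -> : (s * s.-1 + c.+1 * s = s * s.-1 + c * s + s)%N by lia.
rewrite (exprD _ (_ + _)%N).
have mulE (X Y Z D V : C) : X * Y * D * (Z * V) = X * (Y * Z) * D * V by ring.
exact: mulE.
Qed.

Lemma qpoch_inv (a b : C) n : 1 - a * b ^+ n != 0 ->
  (qpoch a b n)^-1 = (1 - a * b ^+ n) / qpoch a b n.+1.
Proof. by move=> nz; rewrite qpochS invfM mulrCA mulfV // mulr1. Qed.

(** A cancelled factor: [1 / (q)_n = q ^ n / (q)_n + 1 / (q)_(n-1)] with [n = N - s], or the same
    with [q ^ 2] for the innermost denominator. *)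
Lemma nested_succ x b cs : (cs != [::]) || (b == 1%N) ->
  shift_rel 1 (nested x (b.+1 :: cs)) (fun s => q ^+ s * nested x (b :: cs) s)
    (nested x (b.+1 :: cs)).
Proof.
case: cs => [|c cs] /=.
  move=> /eqP ->; split=> [|s]; first by rewrite !muln0 !mul1r.
  have q2E : q ^+ 2 * q ^+ 2 ^+ s = q ^+ s.+1 * q ^+ s.+1.
    by rewrite -exprM -!exprD; congr (_ ^+ _); lia.
  have nz : 1 - q ^+ 2 * q ^+ 2 ^+ s != 0.
    by rewrite -exprM -exprD addSn; apply: q_not_root.
  rewrite !mul1n !mul0n !mul1r (qpoch_inv nz) q2E.
  by rewrite mulrA -mulrDl addrCA subrr addr0 mul1r.
move=> _; split=> [|N]; first by rewrite /layer !big_ord1 !muln0 !mul1r.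
(* The term [s = N + 1] has no counterpart in the sum up to [N] and is split off. *)
rewrite /layer mul1r mulr_sumr big_ord_recr [X in _ = X + _]big_ord_recr /=.
rewrite addrAC -big_split; congr (_ + _); last first.
  have -> : (N.+1 * N + b.+1 * N.+1 = N.+1 + (N.+1 * N + b * N.+1))%N by lia.
  rewrite exprD.
  have mulE (X Y Z D V : C) : X * (Z * Y) / D * V = Z * (X * Y / D * V) by ring.
  exact: mulE.
apply: eq_bigr => s _ /=; have sN := ltn_ord s.
have nz : 1 - q * q ^+ (N - s) != 0 by rewrite -exprS.
have -> : (s * s.-1 + b.+1 * s = s * s.-1 + b * s + s)%N by lia.
rewrite (qpoch_inv nz) subSn // (exprD _ (_ + _)%N).
have -> : q ^+ N.+1 = q ^+ s * (q * q ^+ (N - s)).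
  by rewrite -exprS -exprD -subSn // subnKC // ltnW.
have mulE (X Y Z W D V : C) : X * (Y * Z) / D * V =
  Z * W * (X * Y / D * V) + X * (Y * Z) * ((1 - W) / D) * V by ring.
exact: mulE.
Qed.

Lemma weight_cons x c p a :
  x ^+ (size (c :: p)).+1 * q ^+ (sumn (c :: p) + a) =
  x ^+ (size p).+1 * q ^+ (sumn p + a) * x * q ^+ c.
Proof.
rewrite /= [x ^+ (size p).+2]exprS -addnA (exprD _ c).
have mulE (S Q A : C) : x * S * (A * Q) = S * Q * x * A by ring.
exact: mulE.
Qed.

(** The relation of [nested_succ] is carried outwards: the layer of [a] absorbs [q ^+ s], and every
    entry [c] of [p] contributes [x * q ^+ c] and is raised by two. *)
Lemma nested_contiguous x p a b t : (t != [::]) || (b == 1%N) ->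
  shift_rel (x ^+ (size p).+1 * q ^+ (sumn p + a)) (nested x (p ++ a :: b.+1 :: t))
   (nested x (p ++ a.+1 :: b :: t))
   (nested x (map (addn 2) p ++ a.+2 :: b.+1 :: t)).
Proof.
move=> tb; elim: p => [|c p IHp].
  have := layer_shift x (qpoch q q) a (nested_succ x tb).
  rewrite mul1r => -[h0 hS]; split=> [|s].
    exact: etrans h0 (layerS _ _ _ _ _).
  by apply: etrans (hS s) _; rewrite layerS.
rewrite [map _ _]/= !cat_cons !nested_cons; try by case: (p).
by rewrite weight_cons; apply: layer_shift.
Qed.

Lemma multisum_contiguous x p a b t N : (t != [::]) || (b == 1%N) ->
  multisum x (p ++ a :: b.+1 :: t) N.+1 =
  multisum x (p ++ a.+1 :: b :: t) N.+1 + x ^+ (size p).+1 * q ^+ (sumn p + a) *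
   multisum x (map (addn 2) p ++ a.+2 :: b.+1 :: t) N.
Proof.
case: p => [|c p] tb.
  have [_] := layer_shift x (fun=> 1) a (nested_succ x tb).
  by move=> /(_ N); rewrite mul1r layerS.
rewrite weight_cons.
by have [_ /(_ N)] := layer_shift x (fun=> 1) c (nested_contiguous x p a tb).
Qed.

(** Raising all weights by one multiplies each term by [q] to the sum of the variables, which
    [x * q] does too; the auxiliary entry carries no [x]. *)
Lemma multisum_map_succ x cs a N : cs != [::] ->
  multisum x (rcons (map succn cs) a) N = multisum (x * q) (rcons cs a) N.
Proof.
have layer_xq den c u v M : u =1 v ->
    layer x den c.+1 u M = layer (x * q) den c v M.
  move=> uv; apply: eq_bigr => s _; rewrite uv.
  have -> : (s * s.-1 + c.+1 * s = s + (s * s.-1 + c * s))%N by lia.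
  by rewrite exprD exprMn !mulrA.
have nested_xq ds : nested x (rcons (map succn ds) a) =1 nested (x * q) (rcons ds a).
  elim: ds => [|d ds IHds] //= M.
  have r0 T (e : T) es : rcons es e <> [::] by case: es.
  case E: (rcons (map _ ds) a) => [|e es]; first by case: (r0 _ _ _ E).
  case E': (rcons ds a) => [|e' es']; first by case: (r0 _ _ _ E').
  by rewrite -E -E'; apply: layer_xq.
by case: cs => [|c cs] // _; apply: layer_xq.
Qed.

(** The auxiliary entry 1 stands for a factor [q ^+ s] in the innermost variable, which its own
    weight can absorb. *)
Lemma multisum_last x p a N :
  multisum x (rcons p a ++ [:: 1%N]) N = multisum x (rcons p a.+1 ++ [:: 2%N]) N.
Proof.
have base den M : layer x den a (nested x [:: 1%N]) M =
                  layer x den a.+1 (nested x [:: 2%N]) M.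
  rewrite -layerS; apply: eq_layer => s.
  by rewrite /= mul0n mul1n mul1r.
have nested_last ds :
    nested x (rcons ds a ++ [:: 1%N]) =1 nested x (rcons ds a.+1 ++ [:: 2%N]).
  elim: ds => [|d ds IHds] M; first exact: base.
  rewrite !rcons_cons !cat_cons !nested_cons; try by case: (ds).
  exact: eq_layer.
by case: p => [|c p]; [exact: base|exact: eq_layer].
Qed.

End Layers.

(** * The recurrence in [j] and [r] *)

Section Recurrence.
Variables (C : comNzRingType) (x q : C) (F G : seq nat -> C).
Hypothesis contF : contiguous x q F.
Hypothesis F_last : forall p a, F (rcons p a ++ [:: 1%N]) = F (rcons p a.+1 ++ [:: 2%N]).
Hypothesis FG : forall cs a, cs != [::] -> F (rcons (map succn cs) a) = G (rcons cs a).

(** This is [h j r], with [F] taken at [x] and [G] at [x * q]. The block of 2s has [r.+1] entries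
    because the auxiliary one, of trivial weight, is included. *)
Definition at_weights (E : seq nat -> C) k j r :=
  E (nseq j 0%N ++ nseq (k - (j + r)) 1%N ++ nseq r.+1 2%N).

(* Bound on [f 1] imposed by the value [a] of [f 0] in [admissible k j r f]. *)
Definition next_bound (k j r a : nat) : nat :=
  if (a + r <= j)%N then (k - a - odd (j - r - a))%N else (k + j - (r + 2 * a))%N.

Let next_boundSS k j r a : next_bound k j.+1 r.+1 a = next_bound k j r a.
Proof. by rewrite /next_bound addnS ltnS !subSS addnS addSn subSS. Qed.

Let next_boundS0 k j a : (a <= j)%N -> next_bound k j 1 a = next_bound k j.+1 0 a.
Proof.
rewrite /next_bound addn0 addn1 subn0 => aj; rewrite leqW //.
move: aj; rewrite leq_eqVlt => /predU1P[->|aj].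
  by rewrite ltnn subSn // subnn /=; lia.
have -> : (j.+1 - a = (j - 1 - a).+2)%N by lia.
by rewrite aj /= negbK.
Qed.

Let next_bound_last k j r : (0 < r)%N -> next_bound k j r j = (k - (j + r))%N.
Proof.
move=> r0; rewrite /next_bound leqNgt -[X in (X < _)%N]addn0 ltn_add2l r0 /=; lia.
Qed.

Let at0 k r : (0 < k)%N -> (r <= k)%N ->
  at_weights F k 0 r = at_weights G k (k - r) 0.
Proof.
move=> k0 rk; rewrite /at_weights add0n addn0 subKn //.
have -> : nseq 0 0%N ++ nseq (k - r) 1%N ++ nseq r.+1 2%N =
    rcons (map succn (nseq (k - r) 0%N ++ nseq r 1%N)) 2.
  by rewrite map_cat !map_nseq -cats1 -catA -nseqSr cats0.
by rewrite FG -?size_eq0 ?size_cat ?size_nseq ?subnK -?cats1 -?catA // -lt0n.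
Qed.

Let atSS k j r : (j.+1 + r.+1 <= k)%N ->
  at_weights F k j.+1 r.+1 =
  at_weights F k j r + x ^+ j.+1 * at_weights F k 0 (j + r).+2.
Proof.
move=> jrk; rewrite /at_weights (contiguous_shift contF).
by congr (F (_ ++ nseq _ _ ++ _) + _ * F (nseq _ _ ++ nseq _ _)); lia.
Qed.

Let atS0 k j : (j.+1 <= k)%N ->
  at_weights F k j.+1 0 =
  at_weights F k j 1 + x ^+ j.+1 * at_weights F k 0 j.+1.
Proof.
move=> jk; rewrite /at_weights (contiguous_shift contF) cats0 !addn0 addn1.
(* For [r = 0] the shift has lowered the auxiliary entry to 1; [F_last] restores it to 2. *)
congr (_ + _); rewrite -[(k - j.+1).+2]addn1 nseqD -addn1 nseqD !catA.
by rewrite !cats1 -[rcons (rcons _ _) _]cats1 F_last !cats1 -!cats1 -!catA.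
Qed.

(** Induction on [j]: a contiguous relation splits off the term with the largest [a], and for
    smaller [a] the value of [next_bound] is the same at [j + 1, r + 1] as at [j, r], and at
    [j + 1, 0] as at [j, 1]. *)
Lemma at_weights_rec k j r : (0 < k)%N -> (j + r <= k)%N ->
  at_weights F k j r =
  \sum_(a < j.+1) x ^+ a * at_weights G k (next_bound k j r a) 0.
Proof.
move=> k0; elim: j r => [|j IHj] [|r] jrk.
- by rewrite big_ord1 at0 // mul1r /next_bound /= !subn0.
- by rewrite big_ord1 at0 // mul1r next_bound_last.
- rewrite addn0 in jrk; rewrite atS0 // at0 // IHj ?addn1 //.
  rewrite [RHS]big_ord_recr; congr (_ + _ * at_weights G _ _ _) => /=.
    by apply: eq_bigr => a _; rewrite next_boundS0 // -ltnS.
  by rewrite /next_bound addn0 leqnn !subn0 subnn /= subn0.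
have jrk' : ((j + r).+2 <= k)%N by rewrite -addnS -addSn.
rewrite atSS // at0 // IHj; last by rewrite ltnW // ltnW.
rewrite [RHS]big_ord_recr; congr (_ + _ * at_weights G _ _ _) => /=.
  by apply: eq_bigr => a _; rewrite next_boundSS.
by rewrite next_bound_last // addSn addnS.
Qed.

End Recurrence.

(** * Bounds and limits *)

Lemma one_sub_expr_neq0 (C : numFieldType) (q : C) n :
  `|q| < 1 -> 1 - q ^+ n.+1 != 0.
Proof.
move=> q1; rewrite subr_eq0; apply/eqP => /(congr1 (fun z => `|z|)).
rewrite normrX normr1 => qn1; have : `|q| ^+ n.+1 < 1 by rewrite exprn_ilt1.
by rewrite -qn1 ltxx.
Qed.

Lemma nested0 (C : fieldType) (q x : C) cs : nested q x cs 0 = 1.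
Proof.
elim: cs => [|c [|c' cs] IHcs] //; first by rewrite /= muln0 qpoch0 divr1.
by rewrite nested_cons // /layer big_ord1 IHcs !muln0 qpoch0 divr1 !mulr1.
Qed.

Section Bounds.
Variables (C : numFieldType) (q p : C).
Hypothesis q_norm : `|q| = p.
Hypothesis p_lt1 : p < 1.
Local Notation K := (1 - p)^-1.

Let p_ge0 : 0 <= p. Proof. by rewrite -q_norm. Qed.

Let K_ge1 : 1 <= K.
Proof. by rewrite invf_ge1 ?subr_gt0 // gerBl. Qed.

Let K_ge0 : 0 <= K.
Proof. exact: le_trans ler01 K_ge1. Qed.

Lemma inv_qpoch_le a N : `|a| <= p -> `|(qpoch a a N)^-1| <= K ^+ N.
Proof.
move=> ap; elim: N => [|N IHN]; first by rewrite qpoch0 invr1 normr1.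
rewrite qpochS invfM normrM exprSr ler_pM // normfV.
have an : `|a * a ^+ N| <= p.
  rewrite -exprS normrX (le_trans (lerXn2r _ _ _ ap)) ?nnegrE //.
  by rewrite exprS ler_piMr // exprn_ile1 // ltW.
have h : 1 - p <= `|1 - a * a ^+ N|.
  apply: le_trans (lerB_dist _ _); rewrite normr1 lerD2l lerN2 //.
by rewrite lef_pV2 // posrE ?subr_gt0 // (lt_le_trans _ h) ?subr_gt0.
Qed.

(** The factor [K ^+ s] in the bounded sum accounts for the growth of the inner nested sum. *)
Variable B : C.
Hypothesis sum_le : forall M, \sum_(s < M) p ^+ (s * s.-1) * K ^+ s <= B.

Let B_ge1 : 1 <= B.
Proof. by have := sum_le 1; rewrite big_ord1 muln0 mulr1. Qed.

Let B_ge0 : 0 <= B.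
Proof. exact: le_trans ler01 B_ge1. Qed.

Lemma nested_le x cs N : `|x| <= 1 -> `|nested q x cs N| <= K ^+ N * B ^+ size cs.
Proof.
move=> x1; elim: cs N => [|c cs IHcs] N.
  by rewrite /= normr1 mulr1 exprn_ege1.
case cs0 : (cs != [::]); last first.
  move/negbFE/eqP: cs0 => -> /=; rewrite normrM normrX [leLHS]mulrC ler_pM ?exprn_ge0 //.
    by apply: inv_qpoch_le; rewrite normrX q_norm expr2 ler_piMr // ltW.
  by rewrite expr1 (le_trans _ B_ge1) // q_norm exprn_ile1 // ltW.
rewrite nested_cons // /layer (le_trans (ler_norm_sum _ _ _)) //.
apply: (@le_trans _ _ (\sum_(s < N.+1) K ^+ N * (p ^+ (s * s.-1) * K ^+ s) *
                          B ^+ size cs)); last first.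
  rewrite -mulr_suml -mulr_sumr exprS mulrA ler_wpM2r ?exprn_ge0 //.
  by rewrite ler_wpM2l ?exprn_ge0.
apply: ler_sum => s _; have sN : (s <= N)%N by rewrite -ltnS.
(* The denominator costs [K ^+ (N - s)] and the inner sum [K ^+ s]; another [K ^+ s >= 1] is spent
   so that the same [B] serves every layer. *)
have -> : K ^+ N * (p ^+ (s * s.-1) * K ^+ s) * B ^+ size cs =
    1 * (p ^+ (s * s.-1) * 1) * K ^+ (N - s) * (K ^+ s * (K ^+ s * B ^+ size cs)).
  by rewrite -[in K ^+ N](subnK sN) exprD; ring.
rewrite normrM ler_pM //.
  rewrite !normrM !normrX q_norm; apply: ler_pM => //.
    by rewrite mulr_ge0 ?exprn_ge0.
  - apply: ler_pM; rewrite ?exprn_ge0 ?exprn_ile1 //.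
    by rewrite exprD ler_wpM2l ?exprn_ge0 // exprn_ile1 // ltW.
  by apply: inv_qpoch_le; rewrite q_norm.
apply: le_trans (IHcs _) _.
by rewrite ler_peMl ?exprn_ege1 // mulr_ge0 ?exprn_ge0.
Qed.

Lemma multisum_term_le x c cs s : `|x| <= 1 ->
  `|x ^+ s * q ^+ (s * s.-1 + c * s) / 1 * nested q x cs s| <=
  `|x| ^+ s * (p ^+ (s * s.-1) * K ^+ s) * B ^+ size cs.
Proof.
move=> x1; rewrite divr1 !normrM !normrX exprD q_norm.
have -> : `|x| ^+ s * (p ^+ (s * s.-1) * K ^+ s) * B ^+ size cs =
   `|x| ^+ s * (p ^+ (s * s.-1)) * (K ^+ s * B ^+ size cs) by ring.
rewrite ler_pM ?mulr_ge0 ?exprn_ge0 ?nested_le //.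
by rewrite ler_wpM2l ?exprn_ge0 // ler_piMr ?exprn_ge0 // exprn_ile1 // ltW.
Qed.

Lemma multisum_abs_le x c cs N : `|x| <= 1 ->
  \sum_(s < N) `|x ^+ s * q ^+ (s * s.-1 + c * s) / 1 * nested q x cs s| <=
  B ^+ (size cs).+1.
Proof.
move=> x1; apply: (@le_trans _ _ (\sum_(s < N) p ^+ (s * s.-1) * K ^+ s * B ^+ size cs)).
  apply: ler_sum => s _; apply: le_trans (multisum_term_le _ _ _ x1) _.
  rewrite ler_wpM2r ?exprn_ge0 // ler_piMl ?mulr_ge0 ?exprn_ge0 //.
  by rewrite exprn_ile1.
by rewrite -mulr_suml exprS ler_wpM2r ?exprn_ge0.
Qed.

(** The term [s = 0] equals 1 and all others contain a factor [x]; the bound is uniform in [N]. *)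
Lemma multisum_sub1_le x cs N : `|x| <= 1 ->
  `|multisum q x cs N - 1| <= `|x| * B ^+ size cs.
Proof.
move=> x1; case: cs => [|c cs] /=; first by rewrite subrr normr0 mulr1.
rewrite /layer big_ord_recl nested0 !muln0 divr1 !mulr1 addrC addKr.
apply: le_trans (ler_norm_sum _ _ _) _.
apply: (@le_trans _ _ (\sum_(s < N) `|x| * (p ^+ (s.+1 * s) * K ^+ s.+1) * B ^+ size cs)).
  apply: ler_sum => s _; rewrite lift0; apply: le_trans (multisum_term_le _ _ _ x1) _.
  rewrite ler_wpM2r ?exprn_ge0 // ler_wpM2r ?mulr_ge0 ?exprn_ge0 //.
  by rewrite exprS ler_piMr // exprn_ile1.
rewrite -mulr_suml -mulr_sumr exprS mulrA ler_wpM2r ?exprn_ge0 // ler_wpM2l //.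
apply: le_trans (sum_le N.+1); rewrite big_ord_recl.
by rewrite lerDr // mulr_ge0 ?exprn_ge0.
Qed.

End Bounds.

(** * A convergent majorant with quadratic exponent *)

Section RealBound.
Variable R : realType.

Lemma sum_expr_half_le M : \sum_(s < M) (2^-1 : R) ^+ s <= 2.
Proof.
suff -> : \sum_(s < M) (2^-1 : R) ^+ s = 2 - 2 * 2^-1 ^+ M.
  by rewrite gerBl mulr_ge0 // exprn_ge0 // invr_ge0.
elim: M => [|M IHM]; first by rewrite big_ord0 expr0; lra.
by rewrite big_ord_recr /= IHM exprS; lra.
Qed.

(** The term is [(p ^ (s - 1) * K) ^ s], whose base is eventually at most 1/2. *)
Lemma sum_theta_bounded (p K : R) : 0 <= p < 1 -> 0 <= K ->
  exists B, forall M, \sum_(s < M) p ^+ (s * s.-1) * K ^+ s <= B.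
Proof.
move=> /andP[p0 p1] K0; pose b s : R := p ^+ (s * s.-1) * K ^+ s.
have b0 s : 0 <= b s by rewrite mulr_ge0 ?exprn_ge0.
have /cvgrPdist_lt/(_ (2^-1 / (K + 1))) [|N _ hN] : (GRing.exp p : R ^nat) @ \oo --> (0 : R).
  by apply: cvg_expr; rewrite ger0_norm.
  by rewrite divr_gt0 ?invr_gt0 ?ltr_wpDl.
have bN s : (N < s)%N -> b s <= 2^-1 ^+ s.
  case: s => // s; rewrite ltnS => Ns; rewrite /b /= mulnC exprM -exprMn lerXn2r //.
  - by rewrite nnegrE mulr_ge0 // exprn_ge0.
  - by rewrite nnegrE invr_ge0.
  have /= := hN s Ns; rewrite sub0r normrN ger0_norm ?exprn_ge0 // => /ltW ps.
  apply: le_trans (ler_wpM2r K0 ps) _.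
  by rewrite mulrAC ler_pdivrMr ?ltr_wpDl // ler_wpM2l ?invr_ge0 ?lerDl.
(* The sum covers the terms up to [N], the summand 1 the later ones. *)
pose A := 1 + \sum_(s < N.+1) b s * 2 ^+ s.
have bA s : b s <= A * 2^-1 ^+ s.
  rewrite exprVn ler_pdivlMr ?exprn_gt0 //.
  have [sN|Ns] := leqP s N.
    rewrite /A (bigD1 (Ordinal (sN : (s < N.+1)%N))) //= addrCA lerDl addr_ge0 //.
    by apply: sumr_ge0 => i _; rewrite mulr_ge0 ?exprn_ge0.
  apply: (@le_trans _ _ 1).
    by rewrite -ler_pdivlMr ?exprn_gt0 // mul1r -exprVn bN.
  by rewrite lerDl; apply: sumr_ge0 => i _; rewrite mulr_ge0 ?exprn_ge0.
have A0 : 0 <= A by have := le_trans (b0 0%N) (bA 0%N); rewrite mulr1.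
exists (A * 2) => M; apply: (@le_trans _ _ (\sum_(s < M) A * 2^-1 ^+ s)).
  by apply: ler_sum => s _; apply: bA.
by rewrite -mulr_sumr ler_wpM2l // sum_expr_half_le.
Qed.

End RealBound.

(** * Convergence of sequences in epsilon form *)

Definition converges_to (K : numFieldType) (u : nat -> K) (l : K) : Prop :=
  forall e, 0 < e -> exists N, forall n, (N <= n)%N -> `|l - u n| < e.

Section ConvergesTo.
Variable K : numFieldType.
Implicit Types (u v : nat -> K) (a b c : K).

Lemma converges_to_unique u a b : converges_to u a -> converges_to u b -> a = b.
Proof.
move=> ua ub; apply/eqP; rewrite -subr_eq0 -normr_le0; apply/negPn/negP => ab.
have ab0 : 0 < `|a - b| by rewrite normr_gt0; apply: contraNneq ab => ->; rewrite normr0.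
have e0 : 0 < `|a - b| / 2 by rewrite divr_gt0.
have [N1 h1] := ua _ e0; have [N2 h2] := ub _ e0.
have := ltrD (h1 (maxn N1 N2) (leq_maxl _ _)) (h2 (maxn N1 N2) (leq_maxr _ _)).
rewrite -splitr => /(le_lt_trans (ler_normB _ _)).
by rewrite opprB addrA subrK ltxx.
Qed.

Lemma converges_toD u v a b : converges_to u a -> converges_to v b ->
  converges_to (fun n => u n + v n) (a + b).
Proof.
move=> ua vb e e0; have e2 : 0 < e / 2 by rewrite divr_gt0.
have [N1 h1] := ua _ e2; have [N2 h2] := vb _ e2.
exists (maxn N1 N2) => n; rewrite geq_max => /andP[/h1 n1 /h2 n2].
rewrite opprD addrACA; apply: le_lt_trans (ler_normD _ _) _.
by rewrite [ltRHS]splitr ltrD.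
Qed.

Lemma converges_toZ c u a : converges_to u a -> converges_to (fun n => c * u n) (c * a).
Proof.
move=> ua e e0; have c0 : 0 < `|c| + 1 by rewrite ltr_wpDl.
have [|N h] := ua (e / (`|c| + 1)); first by rewrite divr_gt0.
exists N => n /h; rewrite ltr_pdivlMr // => ce.
rewrite -mulrBr normrM mulrC; apply: le_lt_trans ce.
by rewrite ler_wpM2l // lerDl.
Qed.

Lemma converges_toS u a : converges_to u a -> converges_to (fun n => u n.+1) a.
Proof. by move=> ua e /ua[N h]; exists N => n Nn; apply/h/leqW. Qed.

(** The order of [K] may be partial, as on the complex numbers; [b] is real so that a failing
    inequality can be reversed. *)
Lemma converges_to_le u a c b : b \is Num.real -> converges_to u a ->
  (forall n, `|u n - c| <= b) -> `|a - c| <= b.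
Proof.
move=> b_real ua ub; rewrite real_leNgt ?normr_real //; apply/negP => ba.
have [|N h] := ua (`|a - c| - b); first by rewrite subr_gt0.
have := ltr_leD (h N (leqnn N)) (ub N).
by rewrite subrK => /(le_lt_trans (ler_normD _ _)); rewrite addrA subrK ltxx.
Qed.

End ConvergesTo.

Section ComplexLimits.
Variable R : realType.
Local Notation C := R[i].

Lemma norm_complexE (z : C) : exists2 t : R, 0 <= t & `|z| = t%:C%C.
Proof.
have /complex_realP[t zt] := normr_real z.
by exists t => //; rewrite -ler0c -zt.
Qed.

Lemma gt0_complexE (e : C) : 0 < e -> exists2 t : R, 0 < t & e = t%:C%C.
Proof.
move=> e0; have /complex_realP[t et] := gtr0_real e0.
by exists t => //; rewrite -ltcR -et.
Qed.

Lemma converges_to_real_complex (f : nat -> R) (a : R) :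
  f @ \oo --> a -> converges_to (fun n => (f n)%:C%C) a%:C%C.
Proof.
move=> /cvgrPdist_lt fa e /gt0_complexE[t t0 ->].
have [N _ hN] := fa t t0; exists N => n /hN /=.
by rewrite -rmorphB /= normc_def /= expr0n /= addr0 sqrtr_sqr ltcR.
Qed.

Lemma cvg_of_bounded_real (u : nat -> R) (B : R) :
  (forall M, \sum_(s < M) `|u s| <= B) -> cvgn (fun M => \sum_(s < M) u s).
Proof.
move=> uB.
have -> : (fun M => \sum_(s < M) u s) = series u.
  by rewrite seriesEord.
apply: normed_cvg; apply: nondecreasing_is_cvgn.
  by apply: nondecreasing_series => n _ _; rewrite normr_ge0.
by exists B => _ [M _ <-]; rewrite /normed_series_of seriesEord; apply: uB.
Qed.

(** The modulus dominates the real and imaginary parts, so both series converge absolutely. *)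
Lemma cvg_of_bounded (u : nat -> C) (B : C) :
  (forall M, \sum_(s < M) `|u s| <= B) ->
  exists l, converges_to (fun M => \sum_(s < M.+1) u s) l.
Proof.
move=> uB; have /complex_realP[b Bb] : B \is Num.real.
  by rewrite ger0_real //; have := uB 0; rewrite big_ord0.
have leRe (f : C -> R) : (forall z, (`|f z|%:C)%C <= `|z|) ->
    forall M, \sum_(s < M) `|f (u s)| <= b.
  move=> fz M; rewrite -lecR -Bb rmorph_sum; apply: le_trans (uB M).
  by apply: ler_sum => s _; apply: fz.
have cRe := cvg_of_bounded_real (u := fun s => complex.Re (u s)) (leRe _ (@normc_ge_Re R)).
have normc_ge_Im (z : C) : (`|complex.Im z|%:C)%C <= `|z|.
  rewrite -normrN -ReiNIm (le_trans (normc_ge_Re _)) // normrM (normc_def 'i%C) /=.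
  by rewrite expr0n expr1n add0r sqrtr1 mulr1.
have cIm := cvg_of_bounded_real (u := fun s => complex.Im (u s)) (leRe _ normc_ge_Im).
have := converges_toD (converges_to_real_complex cRe)
  (converges_toZ 'i%C (converges_to_real_complex cIm)).
set l := (X in converges_to _ X) => ul; exists l => e /ul[N h]; exists N => n /leqW/h.
rewrite !rmorph_sum /= mulr_sumr -big_split /=.
by under eq_bigr do rewrite -complexE.
Qed.

End ComplexLimits.

(** * Unordered sums *)

(* Along finite sets that contain [e n], the partial sum differs from the one
   over [e n] by at most a tail of the convergent majorant [y]. *)
Lemma has_sum_exhaustion (K : numFieldType) (I : choiceType) (D : set I)
    (x y : I -> K) (e : nat -> seq I) (S L : K) :
  (forall n, uniq (e n)) ->
  (forall m n, (m <= n)%N -> {subset e m <= e n}) ->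
  (forall n i, i \in e n -> D i) -> (forall i, D i -> exists n, i \in e n) ->
  (forall i, D i -> `|x i| <= y i) ->
  converges_to (fun n => \sum_(i <- e n) y i) L ->
  converges_to (fun n => \sum_(i <- e n) x i) S ->
  has_sum D (x : I -> K^o) (S : K^o).
Proof.
have totF := @totally_filter I.
move=> e_uniq e_sub eD De xy yL xS; apply/cvgrPdist_lt => eps eps0.
have e2 : 0 < eps / 2 by rewrite divr_gt0.
have e4 : 0 < eps / 2 / 2 by rewrite divr_gt0.
have [N1 h1] := xS _ e2; have [N2 h2] := yL _ e4.
pose n := maxn N1 N2; exists [fset i in e n]%fset => // B /= /fsubsetP AB.
(* As [e] increases, a single [e m] contains all members of [D] in a given finite list. *)
have /(_ B)[m0 hm0] : forall A : seq I, exists m, forall i, i \in A -> D i -> i \in e m.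
  elim=> [|i A [m hm]]; first by exists 0%N.
  have [/De[m' hm']|nDi] := pselect (D i); last first.
    by exists m => k; rewrite inE => /predU1P[->|/hm].
  exists (maxn m m') => k; rewrite inE => /predU1P[-> _|kA Dk].
    exact: e_sub (leq_maxr _ _) _ hm'.
  exact: e_sub (leq_maxl _ _) _ (hm _ kA Dk).
pose m := maxn n m0.
have -> : partial_sum (patch (fun=> 0) D (x : I -> K^o)) B =
          \sum_(i <- e m | i \in B) x i.
  rewrite /partial_sum -(big_seq_fsetE _ _ predT) /=.
  transitivity (\sum_(i <- B | i \in D) x i).
    by rewrite [RHS]big_mkcond; apply: eq_bigr.
  rewrite -[LHS]big_filter -[RHS]big_filter; apply: perm_big; apply: uniq_perm.
  - by rewrite filter_uniq.
  - by rewrite filter_uniq.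
  move=> i; rewrite !mem_filter andbC; apply: andb_id2l => iB.
  apply/idP/idP => [/set_mem Di|/eD /mem_set //].
  by apply: e_sub (leq_maxr _ _) _ (hm0 _ iB Di).
have split_sum (z : I -> K) : \sum_(i <- e m) z i =
    \sum_(i <- e n) z i + \sum_(i <- e m | i \notin e n) z i.
  rewrite (bigID [in e n]) /=; congr (_ + _); rewrite -big_filter.
  apply: perm_big; apply: uniq_perm; rewrite ?filter_uniq // => i.
  rewrite mem_filter andb_idr // => /e_sub -> //; exact: leq_maxl.
have -> : \sum_(i <- e m | i \in B) x i =
    \sum_(i <- e n) x i + \sum_(i <- e m | (i \in B) && (i \notin e n)) x i.
  rewrite (bigID [in e n]) /=; congr (_ + _); rewrite -big_filter.
  apply: perm_big; apply: uniq_perm; rewrite ?filter_uniq // => i.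
  rewrite mem_filter; apply/idP/idP => [/andP[/andP[]] //|ien].
  by rewrite ien AB ?inE //= (e_sub _ _ (leq_maxl _ _)).
rewrite opprD addrA; apply: le_lt_trans (ler_normB _ _) _.
rewrite [ltRHS]splitr ltr_leD //; first by apply: h1; apply: leq_maxl.
have y0 i : i \in e m -> 0 <= y i by move=> /eD /xy; apply: le_trans.
apply: le_trans (ler_norm_sum _ _ _) _.
apply: (@le_trans _ _ (\sum_(i <- e m | i \notin e n) y i)).
  rewrite [leLHS]big_seq_cond [leRHS]big_seq_cond.
  rewrite [leRHS](bigID [in B]) /=.
  rewrite -[leLHS]addr0 lerD //; last first.
    by apply: sumr_ge0 => i /andP[/andP[/y0]].
  rewrite [leRHS](eq_bigl (fun i => (i \in e m) && ((i \in B) && (i \notin e n)))).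
    by apply: ler_sum => i /andP[/eD /xy].
  by move=> i /=; rewrite -andbA [(i \notin _) && _]andbC.
have Yn := h2 n (leq_maxr _ _).
have Ym := h2 m (leq_trans (leq_maxr _ _) (leq_maxl _ _)).
apply: ltW; rewrite -[ltLHS]ger0_norm; last first.
  by rewrite big_seq_cond sumr_ge0 // => i /andP[/y0].
(* The tail of the majorant is a difference of two distances to [L], each below a quarter of
   [eps]. *)
have -> : \sum_(i <- e m | i \notin e n) y i =
    (L - \sum_(i <- e n) y i) - (L - \sum_(i <- e m) y i).
  by rewrite split_sum; ring.
by apply: le_lt_trans (ler_normB _ _) _; rewrite [ltRHS]splitr ltrD.
Qed.

(** * Multisums as sums over decreasing sequences *)

Fixpoint dec_seqs (k N : nat) : seq (seq nat) :=
  if k is k'.+1 then [seq s :: l | s <- iota 0 N.+1, l <- dec_seqs k' s] else [:: [::]].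

Lemma mem_dec_seqs k N l : (l \in dec_seqs k N) = (size l == k) && path geq N l.
Proof.
elim: k N l => [|k IHk] N [|s l] //.
  by apply/negbTE/negP => /allpairsPdep[? [? []]].
apply/allpairsPdep/idP => [[s' [l' [sN ll [-> ->]]]]|].
  by move: sN ll; rewrite mem_iota IHk eqSS /= ltnS => -> /andP[-> ->].
case/andP => sl /andP[sN pl]; exists s, l; rewrite mem_iota IHk.
by split => //; apply/andP.
Qed.

Lemma dec_seqs_uniq k N : uniq (dec_seqs k N).
Proof.
elim: k N => [|k IHk] N //; apply: allpairs_uniq_dep.
- exact: iota_uniq.
- by move=> s _; apply: IHk.
by move=> [s l] [s' l'] _ _ /= [-> ->].
Qed.

Lemma big_dec_seqsS (V : nmodType) k N (F : seq nat -> V) :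
  \sum_(l <- dec_seqs k.+1 N) F l =
  \sum_(s < N.+1) \sum_(l <- dec_seqs k s) F (nat_of_ord s :: l).
Proof.
have -> : dec_seqs k.+1 N = [seq s :: l | s <- iota 0 N.+1, l <- dec_seqs k s] by [].
by rewrite big_allpairs_dep -[N.+1]subn0 -/(index_iota 0 N.+1) big_mkord subn0.
Qed.

Fixpoint chain_exp (cs l : seq nat) : nat :=
  match cs, l with
  | c :: cs', s :: l' => s * s.-1 + c * s + chain_exp cs' l'
  | _, _ => 0
  end.

Fixpoint chain_den (C : fieldType) (q : C) (N : nat) (l : seq nat) : C :=
  if l is s :: l' then qpoch q q (N - s) * chain_den q s l'
  else qpoch (q ^+ 2) (q ^+ 2) N.

Lemma nested_dec_seqs (C : fieldType) (q : C) cs N :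
  nested q 1 (rcons cs 2%N) N =
  \sum_(l <- dec_seqs (size cs) N) q ^+ chain_exp cs l / chain_den q N l.
Proof.
elim: cs N => [|c cs IHcs] N; first by rewrite /= big_seq1 mul0n.
rewrite rcons_cons nested_cons -?size_eq0 ?size_rcons // /layer.
rewrite big_dec_seqsS.
apply: eq_bigr => s _; rewrite IHcs mulr_sumr; apply: eq_bigr => l _ /=.
by rewrite expr1n mul1r (exprD _ (_ + _)%N) invfM mulrACA.
Qed.

Lemma multisum_dec_seqs (C : fieldType) (q : C) c cs N :
  multisum q 1 (c :: rcons cs 2%N) N =
  \sum_(l <- dec_seqs (size cs).+1 N)
    q ^+ chain_exp (c :: cs) l / chain_den q (head 0%N l) (behead l).
Proof.
rewrite big_dec_seqsS.
apply: eq_bigr => s _; rewrite nested_dec_seqs mulr_sumr; apply: eq_bigr => l _ /=.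
by rewrite expr1n mul1r divr1 (exprD _ (_ + _)%N) mulrA.
Qed.

Lemma chain_expE cs l : (size l <= size cs)%N -> chain_exp cs l =
  (\sum_(i < size l) (nth 0 l i * (nth 0 l i).-1 + nth 0 cs i * nth 0 l i))%N.
Proof.
elim: l cs => [|s l IHl] [|c cs] //=; rewrite ?big_ord0 // => lcs.
by rewrite big_ord_recl /= IHl.
Qed.

Lemma chain_denE (C : fieldType) (q : C) s l : chain_den q s l =
  (\prod_(i < size l) qpoch q q (nth 0 (s :: l) i - nth 0 (s :: l) i.+1)%N) *
  qpoch (q ^+ 2) (q ^+ 2) (nth 0 (s :: l) (size l)).
Proof.
elim: l s => [|t l IHl] s /=; first by rewrite big_ord0 mul1r.
by rewrite big_ord_recl IHl mulrA.
Qed.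

Definition weights (k j r : nat) : seq nat :=
  nseq j 0%N ++ nseq (k - (j + r)) 1%N ++ nseq r 2%N.

Lemma size_weights k j r : (j + r <= k)%N -> size (weights k j r) = k.
Proof. by move=> jrk; rewrite !size_cat !size_nseq; lia. Qed.

(** The weight is [1 - [i < j] + [k - r <= i]] in 0-based indices, stated without subtraction. *)
Lemma nth_weights k j r i : (j + r <= k)%N -> (i < k)%N ->
  (nth 0 (weights k j r) i + (i < j) = (k - r <= i).+1)%N.
Proof.
move=> jrk ik; rewrite /weights !nth_cat !size_nseq !nth_nseq.
case: (ltnP i j) => ij; first by case: leqP => /=; lia.
have -> : (i - j < k - (j + r))%N = (i < k - r)%N by lia.
by case: ltnP => /=; case: ltnP; lia.
Qed.

Lemma ms_exponentE k j r (s : seq nat) : (j + r <= k)%N -> size s = k ->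
  ms_exponent j r k s = (chain_exp (weights k j r) s)%:Z.
Proof.
move=> jrk sk; rewrite chain_expE ?size_weights ?sk // /ms_exponent /part.
rewrite addn1 !big_add1 /= big_mkord [X in _ + X]big_geq_mkord big_mkord.
rewrite (@big_ord_widen _ _ _ j k (fun i => (nth 0%N s i)%:Z)); last by lia.
rewrite [X in _ - X]big_mkcond [X in _ + X]big_mkcond -sumrB -big_split.
rewrite (big_morph Posz PoszD (erefl _)); apply: eq_bigr => i _ /=.
have := nth_weights jrk (ltn_ord i); move: (nth 0%N s i) (nth _ _ _) => n c.
by case: (i < j)%N; case: (k - r <= i)%N => /=; case: n => [|n] /= h; nia.
Qed.

Lemma ms_termE (C : fieldType) (q : C) k j r (s : seq nat) :
  (0 < k)%N -> (j + r <= k)%N -> size s = k ->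
  ms_term q j r k s =
  q ^+ chain_exp (weights k j r) s / chain_den q (head 0%N s) (behead s).
Proof.
move=> k0 jrk sk; rewrite /ms_term ms_exponentE // -exprnP; congr (_ / _).
case: s sk k0 => [|t l] <- //= _; rewrite chain_denE /part; congr (_ * _).
by rewrite big_add1 /= big_mkord.
Qed.

(** * Admissible frequency sequences *)

(** The maximum is split into two inequalities, and [- j] becomes [+ j] modulo 2. Plain functions
    make it easy to drop the first entry. *)
Definition adm_fun (k j r : nat) (f : nat -> nat) : Prop :=
  [/\ forall i, (f i + f i.+1 <= k)%N, (f 0 <= j)%N,
      (2 * f 0 + f 1 <= j + (k - r))%N
    & forall i, (f i + f i.+1)%N = k ->
        odd (i * f i + i.+1 * f i.+1) = odd (k + r + j)].

Lemma admissible_adm_fun k j r (f : freq_seq) : (j + r <= k)%N ->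
  admissible j r k f <-> adm_fun k j r f.
Proof.
move=> jrk.
have mod2 (a : nat) : (a%:Z = k%:Z + r%:Z - j%:Z %[mod 2])%Z <-> odd a = odd (k + r + j).
  split=> h; lia.
split=> -[h1 h2 h3].
  split=> // [||i /h3]; [lia|lia|].
  by rewrite -mod2 PoszD !PoszM.
move=> h4; split=> // [|i /h4]; first by lia.
by rewrite -mod2 PoszD !PoszM.
Qed.

Lemma odd_next_bound k j r a : (a <= j)%N -> (j + r <= k)%N ->
  odd (k + next_bound k j r a) = odd (r + j).
Proof.
move=> aj jrk; rewrite /next_bound; case: (leqP (a + r)) => ar; last by lia.
have [b bE] : exists b, b = (j - r - a)%N by exists (j - r - a)%N.
rewrite -bE; case: (boolP (odd b)) => ob /=; lia.
Qed.

(** If [a + r <= j], the second inequality follows from the first, and parity excludes only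
    [b = k - a], when [j - r - a] is odd. Otherwise the second inequality forces [a + b < k], so
    parity imposes nothing. *)
Lemma leq_next_bound k j r a b : (a <= j)%N -> (j + r <= k)%N ->
  (b <= next_bound k j r a)%N <->
  [/\ (a + b <= k)%N, (2 * a + b <= j + (k - r))%N &
      (a + b)%N = k -> odd b = odd (k + r + j)].
Proof.
move=> aj jrk; rewrite /next_bound; case: (leqP (a + r)) => ar; last first.
  split=> [h|[h1 h2 _]]; last by lia.
  by split; [lia|lia|move=> abk; exfalso; lia].
have [c cE] : exists c, c = (j - r - a)%N by exists (j - r - a)%N.
rewrite -cE; case: (boolP (odd c)) => oc /=; split=> [h|[h1 h2 h3]]; try split; try lia.
Qed.

(** The conditions at [i = 0] amount to the bound on [f 1]. When two neighbours sum to [k], dropping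
    [f 0] changes their weighted sum by [k]; by [odd_next_bound] the required parity changes by [k]
    too. *)
Lemma adm_fun_next k j r (f : nat -> nat) : (j + r <= k)%N ->
  adm_fun k j r f <->
  (f 0 <= j)%N /\ adm_fun k (next_bound k j r (f 0%N)) 0 (fun i => f i.+1).
Proof.
move=> jrk; split=> [[h1 h2 h3 h4]|[h2 [h1 h3 h5 h4]]].
  have f1 : (f 1 <= next_bound k j r (f 0))%N.
    apply/leq_next_bound => //; split=> // f01; rewrite -(h4 0%N) //.
    by rewrite mul0n mul1n.
  split=> //; split=> // [|i fi].
    (* With [r = 0], the bound on [2 * f 1 + f 2] follows from those on [f 1] and [f 1 + f 2]. *)
    by have := h1 1%N; lia.
  have := h4 i.+1 fi; rewrite addn0 odd_next_bound //.
  have -> : (i.+1 * f i.+1 + i.+2 * f i.+2 = i * f i.+1 + i.+1 * f i.+2 + k)%N.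
    by rewrite -fi; lia.
  by rewrite oddD -addnA [odd (k + _)]oddD addbC => /addbI.
move/leq_next_bound: h3 => -[] // h6 h7 h8; split=> // [[|i]|[|i] fi] //.
  by rewrite mul0n mul1n h8.
have -> : (i.+1 * f i.+1 + i.+2 * f i.+2 = i * f i.+1 + i.+1 * f i.+2 + k)%N.
  by rewrite -fi; lia.
by rewrite oddD h4 // addn0 odd_next_bound // -addnA [in RHS]oddD addbC.
Qed.

Lemma next_bound_le k j r a : (j + r <= k)%N -> (a <= j)%N -> (next_bound k j r a <= k)%N.
Proof.
move=> jrk aj.
by have [/(_ (leqnn _))[? _ _] _] := leq_next_bound (next_bound k j r a) aj jrk; lia.
Qed.

Fixpoint adm_seqs (k L j r : nat) : seq (seq nat) :=
  if L is L'.+1 then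
    [seq a :: l | a <- iota 0 j.+1, l <- adm_seqs k L' (next_bound k j r a) 0]
  else [:: [::]].

Lemma adm_seqsP k L j r l : (0 < k)%N -> (j + r <= k)%N ->
  reflect (size l = L /\ adm_fun k j r (nth 0%N l)) (l \in adm_seqs k L j r).
Proof.
move=> k0; elim: L j r l => [|L IHL] j r l jrk.
  apply: (iffP idP) => [|[/size0nil -> _]]; last by rewrite inE.
  rewrite inE => /eqP ->; split=> //; split=> [i|||i]; rewrite !nth_nil ?muln0 //.
  by move=> k0'; rewrite -k0' in k0.
have nbk a : (a <= j)%N -> (next_bound k j r a + 0 <= k)%N.
  by rewrite addn0; apply: next_bound_le.
apply: (iffP allpairsPdep) => [[a [l' [aj ll ->]]]|[sl lA]].
  move: aj; rewrite mem_iota add0n ltnS => /= aj.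
  have [/= <- lA] := IHL _ _ _ (nbk _ aj) ll.
  by split=> //; apply/adm_fun_next.
case: l sl lA => // a l [sl] /adm_fun_next -/(_ jrk)[aj lA].
exists a, l; split=> //; first by rewrite mem_iota add0n ltnS.
by apply/IHL; rewrite ?nbk.
Qed.

Lemma adm_seqs_uniq k L j r : uniq (adm_seqs k L j r).
Proof.
elim: L j r => [|L IHL] j r //; apply: allpairs_uniq_dep.
- exact: iota_uniq.
- by move=> s _; apply: IHL.
by move=> [s l] [s' l'] _ _ /= [-> ->].
Qed.

(** Dropping the head lowers the index of every remaining part by one; this produces [x * q] in
    [adm_sumS]. *)
Fixpoint seq_size (l : seq nat) : nat :=
  if l is a :: l' then sumn l' + seq_size l' else 0.

Definition adm_sum (C : comNzRingType) (q x : C) k L j r : C :=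
  \sum_(l <- adm_seqs k L j r) x ^+ sumn l * q ^+ seq_size l.

Lemma adm_sumS (C : comNzRingType) (q x : C) k L j r :
  adm_sum q x k L.+1 j r =
  \sum_(a < j.+1) x ^+ a * adm_sum q (x * q) k L (next_bound k j r a) 0.
Proof.
rewrite /adm_sum.
have -> : adm_seqs k L.+1 j r =
  [seq a :: l | a <- iota 0 j.+1, l <- adm_seqs k L (next_bound k j r a) 0] by [].
rewrite big_allpairs_dep -[j.+1]subn0 -/(index_iota 0 j.+1) big_mkord subn0.
apply: eq_bigr => a _; rewrite mulr_sumr; apply: eq_bigr => l _ /=.
by rewrite exprMn !exprD !mulrA.
Qed.

Lemma seq_sizeE l : seq_size l = (\sum_(i < size l) i * nth 0 l i)%N.
Proof.
elim: l => [|a l IHl] /=; first by rewrite big_ord0.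
rewrite big_ord_recl mul0n add0n IHl sumnE (big_nth 0%N) big_mkord -big_split.
by apply: eq_bigr => i _ /=; rewrite mulSn.
Qed.

Lemma fsize_widen (f : freq_seq) L : (forall i, (L <= i)%N -> f i = 0%N) ->
  fsize f = (\sum_(i < L) i * f i)%N.
Proof.
move=> f0; rewrite /fsize -(big_mkord predT (fun i => i * f i)%N).
rewrite [RHS](bigID [in finsupp f]) /= [X in _ = (_ + X)%N]big1 ?addn0; last first.
  by move=> i; rewrite mem_finsupp negbK => /eqP ->; rewrite muln0.
rewrite -[RHS]big_filter; apply: perm_big; apply: uniq_perm => [||i].
- exact: fset_uniq.
- by rewrite filter_uniq // iota_uniq.
rewrite mem_filter mem_index_iota andb_idr // mem_finsupp => fi0.
by rewrite ltnNge; apply: contra fi0 => /f0 ->.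
Qed.

Definition freq_of_seq (l : seq nat) : freq_seq :=
  [fsfun i in [fset i in iota 0 (size l)]%fset => nth 0%N l i].

Lemma freq_of_seqE l i : freq_of_seq l i = nth 0%N l i.
Proof.
rewrite fsfunE inE /= mem_iota add0n /=.
by case: ltnP => // li; rewrite nth_default.
Qed.

Lemma fsize_freq_of_seq l : fsize (freq_of_seq l) = seq_size l.
Proof.
rewrite (@fsize_widen _ (size l)) => [|i li].
  by rewrite seq_sizeE; apply: eq_bigr => i _; rewrite freq_of_seqE.
by rewrite freq_of_seqE nth_default.
Qed.

Definition adm_freqs k j r L : seq freq_seq := map freq_of_seq (adm_seqs k L j r).

Lemma adm_freqsP k j r L (f : freq_seq) : (0 < k)%N -> (j + r <= k)%N ->
  reflect (admissible j r k f /\ forall i, (L <= i)%N -> f i = 0%N)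
          (f \in adm_freqs k j r L).
Proof.
move=> k0 jrk; apply: (iffP mapP) => [[l /adm_seqsP-/(_ k0 jrk)[sl lA] ->]|[fA f0]].
  have nthE : freq_of_seq l =1 nth 0%N l by move=> i; apply: freq_of_seqE.
  split=> [|i Li]; last by rewrite nthE nth_default // sl.
  by apply/admissible_adm_fun => //; rewrite (funext nthE).
have nthE : nth 0%N (mkseq f L) =1 f.
  move=> i; have [iL|Li] := ltnP i L; first by rewrite nth_mkseq.
  by rewrite nth_default ?size_mkseq // f0.
exists (mkseq f L); last by apply/fsfunP => i; rewrite freq_of_seqE nthE.
apply/adm_seqsP => //; rewrite size_mkseq (funext nthE); split=> //.
exact/admissible_adm_fun.
Qed.

Lemma adm_freqs_uniq k j r L : (0 < k)%N -> (j + r <= k)%N -> uniq (adm_freqs k j r L).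
Proof.
move=> k0 jrk; rewrite map_inj_in_uniq ?adm_seqs_uniq // => l l'.
move=> /adm_seqsP-/(_ k0 jrk)[sl _] /adm_seqsP-/(_ k0 jrk)[sl' _] ll'.
apply: (@eq_from_nth _ 0%N) => [|i _]; first by rewrite sl.
by rewrite -!freq_of_seqE ll'.
Qed.

Lemma adm_freqs_exhaust k j r (f : freq_seq) : (0 < k)%N -> (j + r <= k)%N ->
  admissible j r k f -> exists L, f \in adm_freqs k j r L.
Proof.
move=> k0 jrk fA; exists (\max_(i <- finsupp f) i).+1; apply/adm_freqsP => //.
split=> // i fi; apply/eqP; rewrite -memNfinsupp; apply/negP => /= fi'.
by move: fi; rewrite ltnNge leq_bigmax_seq.
Qed.

Lemma adm_freqs_sum (C : comNzRingType) (q : C) k j r L :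
  \sum_(f <- adm_freqs k j r L) q ^+ fsize f = adm_sum q 1 k L j r.
Proof.
rewrite big_map; apply: eq_bigr => l _.
by rewrite fsize_freq_of_seq expr1n mul1r.
Qed.

(** * Convergence *)

Section Limits.
Variable R : realType.
Local Notation C := R[i].

Lemma sum_theta_bounded_complex (q : C) : `|q| < 1 -> exists B : C,
  forall M, \sum_(s < M) `|q| ^+ (s * s.-1) * (1 - `|q|)^-1 ^+ s <= B.
Proof.
have [p p0 ->] := norm_complexE q; rewrite -(rmorph1 (real_complex R)) ltcR => p1.
have [|B hB] := @sum_theta_bounded _ p (1 - p)^-1 (introT andP (conj p0 p1)).
  by rewrite invr_ge0 subr_ge0 ltW.
exists B%:C%C => M; rewrite -rmorphB -fmorphV.
under eq_bigr do rewrite -!rmorphXn -rmorphM.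
by rewrite -rmorph_sum lecR.
Qed.

(** [xget] selects the limit, with default 0; [lim_multisumP] proves that a limit exists. *)
Definition lim_multisum (q x : C) (cs : seq nat) : C :=
  xget 0 (converges_to (multisum q x cs)).

Lemma lim_multisumP (q x : C) cs : `|q| < 1 -> `|x| <= 1 ->
  converges_to (multisum q x cs) (lim_multisum q x cs).
Proof.
move=> q1 x1; rewrite /lim_multisum; apply: xgetPex.
case: cs => [|c cs].
  by exists 1 => e e0; exists 0%N => n _; rewrite /= subrr normr0.
have [B hB] := sum_theta_bounded_complex q1.
pose u s := x ^+ s * q ^+ (s * s.-1 + c * s) / 1 * nested q x cs s.
apply: (@cvg_of_bounded _ u (B ^+ (size cs).+1)) => M.
exact: (multisum_abs_le erefl q1 hB c cs M x1).
Qed.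

Section Recurrence.
Variables (q : C) (k : nat).
Hypotheses (q1 : `|q| < 1) (k0 : (0 < k)%N).

(** The finite relation mixes truncations at [N + 1] and [N], which have the same limit. *)
Lemma lim_multisum_contiguous x : `|x| <= 1 -> contiguous x q (lim_multisum q x).
Proof.
move=> x1 p a b t tb.
apply: (converges_to_unique (converges_toS (lim_multisumP _ q1 x1))).
have -> : (fun N => multisum q x (p ++ a :: b.+1 :: t) N.+1) = (fun N =>
    multisum q x (p ++ a.+1 :: b :: t) N.+1 + x ^+ (size p).+1 * q ^+ (sumn p + a) *
    multisum q x (map (addn 2) p ++ a.+2 :: b.+1 :: t) N).
  apply/funext => N; apply: multisum_contiguous tb => n.
  exact: one_sub_expr_neq0.
apply: converges_toD; last by apply: converges_toZ; apply: lim_multisumP.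
by apply: converges_toS; apply: lim_multisumP.
Qed.

Definition limit_sum (x : C) j r : C := at_weights (lim_multisum q x) k j r.

Lemma limit_sum_rec x j r : `|x| <= 1 -> (j + r <= k)%N ->
  limit_sum x j r = \sum_(a < j.+1) x ^+ a * limit_sum (x * q) (next_bound k j r a) 0.
Proof.
move=> x1 jrk.
have lim_ext y z cs ds : (forall N, multisum q y cs N = multisum q z ds N) ->
    lim_multisum q y cs = lim_multisum q z ds.
  by move=> E; rewrite /lim_multisum (funext E).
have lim_last p a : lim_multisum q x (rcons p a ++ [:: 1%N]) =
    lim_multisum q x (rcons p a.+1 ++ [:: 2%N]).
  by apply: lim_ext => N; apply: multisum_last.
have lim_succ cs a : cs != [::] ->
    lim_multisum q x (rcons (map succn cs) a) = lim_multisum q (x * q) (rcons cs a).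
  by move=> cs0; apply: lim_ext => N; apply: multisum_map_succ.
exact: (at_weights_rec (lim_multisum_contiguous x1) lim_last lim_succ k0 jrk).
Qed.

Variable B : C.
Hypothesis hB : forall M, \sum_(s < M) `|q| ^+ (s * s.-1) * (1 - `|q|)^-1 ^+ s <= B.

Let B_ge0 : 0 <= B.
Proof. by have := hB 0; rewrite big_ord0. Qed.

Lemma limit_sum_sub1_le x j r : `|x| <= 1 -> (j + r <= k)%N ->
  `|limit_sum x j r - 1| <= `|x| * B ^+ k.+1.
Proof.
move=> x1 jrk; apply: (converges_to_le _ (lim_multisumP _ q1 x1)) => [|N].
  by rewrite ger0_real // mulr_ge0 ?exprn_ge0.
have <- : size (nseq j 0%N ++ nseq (k - (j + r)) 1%N ++ nseq r.+1 2%N) = k.+1.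
  by rewrite !size_cat !size_nseq; lia.
exact: (multisum_sub1_le erefl q1 hB).
Qed.

Lemma sum_expr_le (y : C) j : 0 <= y <= 1 -> (j <= k)%N ->
  \sum_(a < j.+1) y ^+ a <= 1 + k%:R * y.
Proof.
move=> /andP[y0 y1] jk; rewrite big_ord_recl lerD2l.
apply: (@le_trans _ _ (\sum_(a < j) y)).
  by apply: ler_sum => a _; rewrite lift0 exprS ler_piMr // exprn_ile1.
by rewrite sumr_const card_ord -[y *+ j]mulr_natl ler_wpM2r // ler_nat.
Qed.

(* Each step of the recurrence multiplies [x] by [q]; after [L] steps the two
   sides differ by at most the distance of both to [1] at [x * q ^ L]. *)
Lemma adm_sum_sub_le x L j r : `|x| <= 1 -> (j + r <= k)%N ->
  `|adm_sum q x k L j r - limit_sum x j r| <=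
  \prod_(i < L) (1 + k%:R * (`|q| ^+ i * `|x|)) * (`|q| ^+ L * `|x| * B ^+ k.+1).
Proof.
elim: L x j r => [|L IHL] x j r x1 jrk.
  rewrite big_ord0 !mul1r distrC /adm_sum big_seq1 mulr1.
  exact: limit_sum_sub1_le.
have xq1 : `|x * q| <= 1 by rewrite normrM mulr_ile1 // ltW.
rewrite adm_sumS limit_sum_rec // -sumrB; apply: le_trans (ler_norm_sum _ _ _) _.
(* The inductive bound at [x * q], whence the raised exponents of the norm of [q]. *)
pose D := \prod_(i < L) (1 + k%:R * (`|q| ^+ i.+1 * `|x|)) * (`|q| ^+ L.+1 * `|x| * B ^+ k.+1).
apply: (@le_trans _ _ (\sum_(a < j.+1) `|x| ^+ a * D)).
  apply: ler_sum => a _; rewrite -mulrBr normrM normrX ler_wpM2l ?exprn_ge0 //.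
  have aj : (a <= j)%N by rewrite -ltnS.
  apply: le_trans (IHL _ _ _ xq1 _) _; first by rewrite addn0 next_bound_le.
  rewrite le_eqVlt; apply/orP; left; apply/eqP; rewrite /D normrM.
  have mulE (u v w : C) : u * (v * w) = w * u * v by ring.
  congr (_ * (_ * _)); last by rewrite exprS mulE.
  by apply: eq_bigr => i _; rewrite exprS (mulE (`|q| ^+ i)).
rewrite -mulr_suml big_ord_recl expr0 mul1r -mulrA ler_wpM2r //.
  rewrite mulr_ge0 ?prodr_ge0 // ?mulr_ge0 ?exprn_ge0 // => i _.
  by rewrite addr_ge0 // !mulr_ge0 ?exprn_ge0.
by apply: sum_expr_le; rewrite ?normr_ge0 //; lia.
Qed.

End Recurrence.

(** The ratio of consecutive terms, [(1 + k * p ^ L) * p], tends to [p < 1], so it is eventually at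
    most the midpoint [rho] of [p] and 1. *)
Lemma prod_expr_cvg0 (p : R) k : 0 <= p < 1 ->
  (fun L => \prod_(i < L) (1 + k%:R * p ^+ i) * p ^+ L) @ \oo --> (0 : R).
Proof.
move=> /andP[p0 p1]; pose u L := \prod_(i < L) (1 + k%:R * p ^+ i) * p ^+ L.
have u0 L : 0 <= u L.
  rewrite mulr_ge0 ?exprn_ge0 // prodr_ge0 // => i _.
  by rewrite addr_ge0 // mulr_ge0 ?exprn_ge0.
pose rho := (1 + p) / 2; have rho01 : 0 <= rho < 1 by rewrite /rho; lra.
have [rho0 rho1] := andP rho01.
have /cvgrPdist_lt/(_ ((1 - p) / 2 / (k%:R + 1))) [|N _ hN] :
    (GRing.exp p : R ^nat) @ \oo --> (0 : R).
  by apply: cvg_expr; rewrite ger0_norm.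
  by rewrite !divr_gt0 ?subr_gt0 ?ltr_wpDl.
have uS L : (N <= L)%N -> u L.+1 <= u L * rho.
  move=> NL; rewrite /u big_ord_recr exprSr /=.
  rewrite [leLHS](_ : _ = u L * ((1 + k%:R * p ^+ L) * p)); last by rewrite /u; ring.
  rewrite ler_wpM2l //; have := hN L NL; rewrite /= sub0r normrN ger0_norm ?exprn_ge0 //.
  rewrite ltr_pdivlMr ?ltr_wpDl // => /ltW pk.
  have kp : k%:R * p ^+ L <= (1 - p) / 2.
    by apply: le_trans pk; rewrite mulrC ler_wpM2l ?exprn_ge0 // lerDl.
  have k0 : 0 <= k%:R * p ^+ L by rewrite mulr_ge0 ?exprn_ge0.
  (* What remains reduces to [(1 - p) ^ 2 >= 0]. *)
  by rewrite /rho; nra.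
have uN n : u (N + n)%N <= u N * rho ^+ n.
  elim: n => [|n IHn]; first by rewrite addn0 mulr1.
  rewrite addnS exprSr mulrA; apply: le_trans (uS _ (leq_addr _ _)) _.
  by rewrite ler_wpM2r.
apply/cvgrPdist_lt => e e0.
have /cvgrPdist_lt/(_ (e / (u N + 1))) [|M _ hM] :
    (GRing.exp rho : R ^nat) @ \oo --> (0 : R).
  by apply: cvg_expr; rewrite ger0_norm.
  by rewrite divr_gt0 // ltr_wpDl.
exists (N + M)%N => // n /= NMn; rewrite sub0r normrN ger0_norm ?u0 //.
have Nn : (N <= n)%N by apply: leq_trans NMn; apply: leq_addr.
rewrite -/(u n) -(subnKC Nn); apply: le_lt_trans (uN _) _.
have /= := hM (n - N)%N; rewrite leq_subRL // => /(_ NMn).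
rewrite sub0r normrN ger0_norm ?exprn_ge0 // ltr_pdivlMr ?ltr_wpDl //.
apply: le_lt_trans; rewrite mulrC ler_wpM2l ?exprn_ge0 // lerDl //.
Qed.

Lemma adm_sum_cvg (q : C) k j r : `|q| < 1 -> (0 < k)%N -> (j + r <= k)%N ->
  converges_to (fun L => adm_sum q 1 k L j r) (limit_sum q k 1 j r).
Proof.
move=> q1 k0 jrk; have [B hB] := sum_theta_bounded_complex q1.
have [p p0 qp] := norm_complexE q.
have p1 : p < 1 by rewrite -ltcR -qp.
have prodE n : (\prod_(i < n) (1 + k%:R * p ^+ i) * p ^+ n)%:C%C =
    \prod_(i < n) (1 + k%:R * (`|q| ^+ i * `|1|)) * (`|q| ^+ n * `|1|) :> C.
  rewrite normr1 !mulr1 qp rmorphM rmorph_prod rmorphXn; congr (_ * _).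
  by apply: eq_bigr => i _; rewrite rmorphD rmorph1 rmorphM rmorph_nat rmorphXn mulr1.
have := converges_to_real_complex (prod_expr_cvg0 k (introT andP (conj p0 p1))).
move=> /(converges_toZ (B ^+ k.+1)) u0 e /u0[N hN]; exists N => n /hN.
have n1 : `|1 : C| <= 1 by rewrite normr1.
have := adm_sum_sub_le q1 k0 hB n n1 jrk; rewrite mulrA -prodE mulrC => bound.
rewrite rmorph0 mulr0 sub0r normrN distrC; apply: le_lt_trans.
have bound_ge0 := le_trans (normr_ge0 _) bound.
by apply: le_trans bound _; rewrite ger0_norm.
Qed.

End Limits.

(** * Majorants and truncations of the multisum *)

Section TupleSums.
Variable C : numFieldType.

Lemma chain_den_norm (q : C) N l : `|q| < 1 ->
  0 < chain_den `|q| N l <= `|chain_den q N l|.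
Proof.
move=> q1; have qpoch_norm (a : C) n : `|a| < 1 ->
    0 < qpoch `|a| `|a| n <= `|qpoch a a n|.
  move=> a1; elim: n => [|n /andP[IH1 IH2]]; first by rewrite !qpoch0 normr1 ltr01 lexx.
  have an : `|a| ^+ n.+1 < 1 by rewrite exprn_ilt1.
  rewrite !qpochS -exprS normrM mulr_gt0 ?subr_gt0 //= ler_pM ?subr_ge0 ?(ltW an) ?(ltW IH1) //.
  by apply: le_trans (lerB_dist _ _); rewrite normr1 -exprS normrX.
elim: l N => [|s l IHl] N /=.
  have := @qpoch_norm (q ^+ 2) N; rewrite normrX; apply.
  by rewrite exprn_ilt1.
have /andP[h1 h2] := qpoch_norm q (N - s)%N q1; have /andP[h3 h4] := IHl s.
by rewrite mulr_gt0 //= normrM ler_pM // ltW.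
Qed.

(** Each factor [1 - a ^ n] has norm at least [1 - |a| ^ n], so the multisum at the norm of [q] is a
    termwise majorant. *)
Lemma ms_term_norm_le (q : C) k j r (s : seq nat) :
  `|q| < 1 -> (0 < k)%N -> (j + r <= k)%N -> size s = k ->
  `|ms_term q j r k s| <= ms_term `|q| j r k s.
Proof.
move=> q1 k0 jrk sk; rewrite !ms_termE // normrM normrX normfV.
rewrite ler_wpM2l ?exprn_ge0 //.
have /andP[h1 h2] := chain_den_norm (head 0%N s) (behead s) q1.
by rewrite lef_pV2 // posrE // (lt_le_trans h1).
Qed.

Definition dec_tuples k N : seq (k.-tuple nat) := pmap insub (dec_seqs k N).

Lemma mem_dec_tuples k N (s : k.-tuple nat) : (s \in dec_tuples k N) = path geq N s.
Proof. by rewrite mem_pmap_sub mem_dec_seqs size_tuple eqxx. Qed.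

Lemma dec_tuples_sum (q : C) k j r N : (0 < k)%N -> (j + r <= k)%N ->
  \sum_(s <- dec_tuples k N) ms_term q j r k s =
  multisum q 1 (rcons (weights k j r) 2%N) N.
Proof.
move=> k0 jrk; have := size_weights jrk; case wE: (weights k j r) => [|c cs] kE.
  by rewrite -kE in k0.
rewrite rcons_cons multisum_dec_seqs -[(size cs).+1]/(size (c :: cs)) kE.
rewrite big_pmap [LHS]big_seq [RHS]big_seq; apply: eq_bigr => l.
rewrite mem_dec_seqs => /andP[sl _].
by rewrite insubT /= ms_termE ?wE //; apply/eqP.
Qed.

End TupleSums.

Theorem theorem1p15 (R : realType) (q : R[i]) (j r k : nat) :
  `|q| < 1 -> (1 <= k)%N -> (j + r <= k)%N ->
  exists S : R[i]^o,
    has_sum [set s : k.-tuple nat | sorted geq s]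
      (fun s => ms_term q j r k s : R[i]^o) S
    /\ has_sum [set f : freq_seq | admissible j r k f]
         (fun f => q ^+ fsize f : R[i]^o) S.
Proof.
move=> q1 k0 jrk; exists (limit_sum q k 1 j r).
have p1 : `| `|q| | < 1 by rewrite normr_id.
have n1 : `|1 : R[i]| <= 1 by rewrite normr1.
have path_sortedE (s : k.-tuple nat) : sorted geq s -> path geq (head 0%N s) s.
  by case: s => -[|t l] //= _ ->; rewrite leqnn.
have dec_sum (z : R[i]) : `|z| < 1 ->
    converges_to (fun N => \sum_(s <- dec_tuples k N) ms_term z j r k s)
      (limit_sum z k 1 j r).
  move=> z1; rewrite (funext (fun N => dec_tuples_sum z N k0 jrk)).
  (* Appending the auxiliary 2 to [weights] gives the list used by [at_weights]. *)
  by rewrite /weights -cats1 -!catA -nseqSr cats0; apply: lim_multisumP.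
have adm_conv (z : R[i]) : `|z| < 1 ->
    converges_to (fun L => \sum_(f <- adm_freqs k j r L) z ^+ fsize f)
      (limit_sum z k 1 j r).
  move=> z1; rewrite (funext (fun L => adm_freqs_sum z k j r L)).
  exact: adm_sum_cvg.
split.
  (* On both sides the majorant is the same series at the norm of [q], whose convergence is the
     instance [p1] of the fact just proved. *)
  apply: (has_sum_exhaustion _ _ _ _ _ (dec_sum _ p1) (dec_sum _ q1)).
  - by move=> N; rewrite pmap_sub_uniq ?dec_seqs_uniq.
  - move=> m n mn s; rewrite !mem_dec_tuples.
    by case: s => -[|t l] //= _ /andP[tm ->]; rewrite (leq_trans tm).
  - by move=> N s; rewrite mem_dec_tuples; apply: path_sorted.
  - by move=> s /path_sortedE ps; exists (head 0%N s); rewrite mem_dec_tuples.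
  - by move=> s _; rewrite ms_term_norm_le ?size_tuple.
apply: (has_sum_exhaustion _ _ _ _ _ (adm_conv _ p1) (adm_conv _ q1)).
- by move=> L; apply: adm_freqs_uniq.
- move=> m n mn f /adm_freqsP-/(_ k0 jrk)[fA f0]; apply/adm_freqsP => //.
  by split=> // i ni; apply: f0; apply: leq_trans ni.
- by move=> L f /adm_freqsP-/(_ k0 jrk)[].
- by move=> f; apply: adm_freqs_exhaust.
- by move=> f _; rewrite normrX.
Qed.
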